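(* Let $F$ be a nonempty convex set in $\mathbb{R}^n$. Then the following statements are equivalent: (1) Every polynomial $f:\mathbb{R}^n\to\mathbb{R}$ which has at least one nonempty convex sub-level set on $F$ and which is bounded below on $F$ attains its infimum on $F$. (2) $F$ is a qFW-set. (3) Every quadratic function $q:\mathbb{R}^n\to\mathbb{R}$ which is convex on $F$ and bounded below on $F$ attains its infimum on $F$. (4) $F$ has no $f$-asymptotes. (5) $T(F)$ is closed for every affine mapping $T:\mathbb{R}^n\to\mathbb{R}^m$ (every $m$). (6) $P(F)$ is closed for every orthogonal projection $P$ of $\mathbb{R}^n$ onto a linear subspace.
   Context: A function $f:\mathbb{R}^n\to\mathbb{R}$ is called quadratic if $f(x)=\frac12 x^{T}Ax+b^{T}x+c$ with $A=A^{T}\in\mathbb{R}^{n\times n}$, $b\in\mathbb{R}^n$, $c\in\mathbb{R}$ ($A=0$ allowed). A sub-level set of $f$ on $F$ is a set $\{x\in F: f(x)\le\alpha\}$ with $\alpha\in\mathbb{R}$. For convex $F$, $f$ is quasi-convex on $F$ if all its sub-level sets on $F$ are convex, and convex on $F$ if the restriction $f_{|F}$ is a convex function. A convex set $F\subset\mathbb{R}^n$ is a qFW-set (quasi-Frank-and-Wolfe set) if every quadratic function which is quasi-convex on $F$ and bounded below on $F$ attains its infimum on $F$. An affine manifold is a nonempty affine subspace of $\mathbb{R}^n$ (single points are allowed). An affine manifold $M$ is an $f$-asymptote of a set $F$ if $F\cap M=\emptyset$ and $\mathrm{dist}(F,M)=\inf\{\|x-y\|: x\in F,\ y\in M\}=0$,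 with $\|\cdot\|$ the Euclidean norm. *)

(* Defs.v *)
(* MathComp-Analysis; R^n is the space of column vectors 'cV[R]_n over
   R : realType. *)
From HB Require Import structures.
From mathcomp Require Import all_boot all_order all_algebra.
From mathcomp Require Import all_classical all_reals all_analysis.
(* Not imported: its notations clash with those of MathComp-Analysis. *)
From mathcomp Require mpoly.

Set Implicit Arguments.
Unset Strict Implicit.
Unset Printing Implicit Defensive.

Import Order.TTheory GRing.Theory Num.Theory.
Import numFieldNormedType.Exports.

Local Open Scope classical_set_scope.
Local Open Scope ring_scope.

Section Euclidean.
Context {R : realType} {n : nat}.
Implicit Types (x y : 'cV[R]_n) (F M : set 'cV[R]_n) (f : 'cV[R]_n -> R).

Definition dotprod x y : R := \sum_(i < n) x i 0 * y i 0.

(* The norm `|x| of the library on matrices is the sup norm; it induces the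
   same topology as enorm, so that [closed] has its usual meaning on R^n. *)
Definition enorm x : R := Num.sqrt (dotprod x x).

(* For nonempty F and M this is the infimum of a nonempty set bounded below
   by 0; it is only used in that case ([inf] is 0 on the empty set). *)
Definition edistance F M : R := inf [set enorm (x - y) | x in F & y in M].

Definition affine_manifold M : Prop :=
  exists (x0 : 'cV[R]_n) (L : {vspace 'cV[R]_n}),
    M = [set x0 + v | v in [set` L]].

Definition f_asymptote F M : Prop :=
  [/\ affine_manifold M, F `&` M = set0 & edistance F M = 0].

Definition sublevel F f (a : R) : set 'cV[R]_n := [set x | F x /\ f x <= a].

Definition polynomial_function f : Prop :=
  exists p : mpoly.mpoly n R, forall x, f x = mpoly.meval (fun i => x i 0) p.

Definition quadratic_function f : Prop :=
  exists (A : 'M[R]_n) (b : 'cV[R]_n) (c : R), A^T = A /\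
    forall x, f x = 2^-1 * (x^T *m A *m x) 0 0 + (b^T *m x) 0 0 + c.

Definition quasi_convex_on F f : Prop := forall a : R, convex_set (sublevel F f a).

Definition bounded_below_on F f : Prop := has_lbound (f @` F).

(* [inf] is a junk value when f is not bounded below on F, so this is only
   meaningful together with [bounded_below_on F f]. *)
Definition attains_infimum_on F f : Prop := exists2 x, F x & f x = inf (f @` F).

Definition qFW_set F : Prop :=
  convex_set F /\
  forall f, quadratic_function f -> quasi_convex_on F f ->
    bounded_below_on F f -> attains_infimum_on F f.

Definition orthogonal_projection (L : {vspace 'cV[R]_n})
    (P : 'cV[R]_n -> 'cV[R]_n) : Prop :=
  forall x, P x \in L /\ forall y, y \in L -> dotprod (x - P x) y = 0.

Definition affine_mapping (m : nat) (T : 'cV[R]_n -> 'cV[R]_m) : Prop :=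
  exists (A : 'M[R]_(m, n)) (b : 'cV[R]_m), forall x, T x = A *m x + b.

End Euclidean.

(* Main.v *)
Require Import Defs.
From HB Require Import structures.
From mathcomp Require Import all_boot all_order all_algebra.
From mathcomp Require Import all_classical all_reals all_analysis.
From mathcomp Require Import ring lra.
From mathcomp Require mpoly.
(* Activates the ring structure on multivariate polynomials and no notation. *)
Import (canonicals) mpoly.

Set Implicit Arguments.
Unset Strict Implicit.
Unset Printing Implicit Defensive.

Import Order.TTheory GRing.Theory Num.Theory.
Import numFieldNormedType.Exports.

Local Open Scope classical_set_scope.
Local Open Scope ring_scope.

(** Why the equivalence holds. Each statement implies the next one by a short
    argument. A quadratic function is a polynomial, and a function that is
    convex on [F] is quasi-convex there. The squared distance to an affine
    manifold is convex and quadratic, so attainment excludes asymptotes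
    ([no_asymptote_of_convex_quadratics]). If the image of [F] under an affine
    map is not closed, the fibre over a missing limit point is an asymptote
    ([closed_image_of_no_asymptote]). Orthogonal projections are affine.

    The return from closed projections to polynomials carries the weight. Closed
    projections mean that [F + V] is closed for every linear subspace [V]
    ([closed_minkowski_sum_of_projections]). Now let [S] be a nonempty convex
    sublevel set on [F] of a polynomial [f] that is bounded below on [F]. Along
    a half-line contained in [S], [f] is a bounded polynomial in one variable,
    hence constant. So directions in which [S] is unbounded are directions of
    invariance of [f] and may be divided out. A single quotient may have new
    unbounded directions, as the epigraph of a parabola shows. Dividing out the
    largest subspace [V] of invariance avoids an iteration: [S + V] is closed,
    and since its part orthogonal to [V] can have no further recession direction,
    this part is compact and [f] attains its minimum on it
    ([attains_infimum_of_closed_sums]). Invariance is stated on the affine hull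
    of [S], where it propagates from [S] because [S] has interior points relative
    to this hull ([eq_on_affine_hull]); a sublevel set of lower dimension needs
    no separate treatment. *)

(** * Linear algebra and Euclidean geometry *)

(** Lets a subspace be specified by a property of its vectors that is not
    decidable, such as invariance of a function. *)
Lemma linear_closed_vspace (K : fieldType) (vT : vectType K) (S : set vT) :
  S 0 -> (forall a u v, S u -> S v -> S (a *: u + v)) ->
  exists L : {vspace vT}, forall x, x \in L <-> S x.
Proof.
move=> S0 Slin.
(* Take a subspace contained in S of maximal dimension. *)
pose P k := `[< exists2 L : {vspace vT}, [set` L] `<=` S & \dim L = k >].
have exP : exists k, P k.
  exists 0%N; apply/asboolP; exists 0%VS; last exact: dimv0.
  by move=> u /=; rewrite memv0 => /eqP ->.
have ubP k : P k -> (k <= \dim {:vT})%N.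
  by move=> /asboolP[L _ <-]; apply: dimvS; exact: subvf.
case: (ex_maxnP exP ubP) => k /asboolP[L LS <-] maxL.
exists L => x; split=> [/LS //|Sx].
apply: contrapT => /negP xL.
have LxS : [set` (L + <[x]>)%VS] `<=` S.
  move=> _ /memv_addP[u uL [_ /vlineP[a ->] ->]].
  by rewrite addrC; apply: Slin => //; exact: LS.
have /maxL : P (\dim (L + <[x]>)%VS) by apply/asboolP; exists (L + <[x]>)%VS.
apply/negP; rewrite -ltnNge (ltn_leqif (dimv_leqif_sup (addvSl L <[x]>))).
by rewrite subv_add subvv /= -memvE.
Qed.

Lemma mulmx_kernel_vspace (K : fieldType) m n (A : 'M[K]_(m, n)) :
  exists L : {vspace 'cV[K]_n}, forall v, v \in L <-> A *m v = 0.
Proof.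
apply: linear_closed_vspace => [|a u v Au Av]; first by rewrite mulmx0.
by rewrite mulmxDr -scalemxAr Au Av scaler0 addr0.
Qed.

Section EuclideanFacts.
Context {R : realType} {n : nat}.
Implicit Types (x y z : 'cV[R]_n) (L : {vspace 'cV[R]_n}).

Lemma dotprodE x y : dotprod x y = (x^T *m y) 0 0.
Proof. by rewrite /dotprod !mxE; apply: eq_bigr => i _; rewrite !mxE. Qed.

Lemma dotprodC (x y : 'cV[R]_n) : dotprod x y = dotprod y x.
Proof. by apply: eq_bigr => i _; rewrite mulrC. Qed.

Lemma dotprodBl x y z :
  dotprod (x - y) z = dotprod x z - dotprod y z.
Proof.
by rewrite /dotprod -sumrB; apply: eq_bigr => i _; rewrite !mxE mulrBl.
Qed.

Lemma dotprodZl (a : R) (x y : 'cV[R]_n) : dotprod (a *: x) y = a * dotprod x y.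
Proof.
by rewrite /dotprod mulr_sumr; apply: eq_bigr => i _; rewrite !mxE mulrA.
Qed.

Lemma dotprodB_sqr x y :
  dotprod (x - y) (x - y) = dotprod x x - 2 * dotprod y x + dotprod y y.
Proof.
by rewrite dotprodBl ![dotprod _ (x - y)]dotprodC !dotprodBl (dotprodC x y); ring.
Qed.

Lemma dotprod_ge0 x : 0 <= dotprod x x.
Proof. by apply: sumr_ge0 => i _; rewrite -expr2 sqr_ge0. Qed.

Lemma enorm_sqr (x : 'cV[R]_n) : enorm x ^+ 2 = dotprod x x.
Proof. by rewrite sqr_sqrtr // dotprod_ge0. Qed.

Lemma dotprod_eq0 x : dotprod x x = 0 -> x = 0.
Proof.
move=> xx0; apply/matrixP => i j; rewrite (ord1 j) mxE.
have ge0 k : true -> 0 <= x k 0 * x k 0 by rewrite -expr2 sqr_ge0.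
have /psumr_eq0P : \sum_(k < n | true) x k 0 * x k 0 = 0 by [].
by move=> /(_ ge0 i isT)/eqP; rewrite mulf_eq0 orbb => /eqP.
Qed.

(** With the vectors of a basis of [L] as the columns of B, the projection is
    B (B^T B)^-1 B^T; the Gram matrix B^T B is invertible because B^T B u = 0
    forces |B u|^2 = 0. *)
Lemma orthogonal_projection_mx L :
  exists P : 'M[R]_n, orthogonal_projection L (mulmx P).
Proof.
pose B : 'M[R]_(n, \dim L) := \matrix_(i, j) (vbasis L)`_j i 0.
have BE (u : 'cV[R]_(\dim L)) : B *m u = \sum_j u j 0 *: (vbasis L)`_j.
  apply/matrixP => i k; rewrite (ord1 k) mxE summxE; apply: eq_bigr => j _.
  by rewrite !mxE mulrC.
have BL u : B *m u \in L.
  rewrite BE; apply: memv_suml => j _; apply: memvZ; apply: vbasis_mem.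
  by apply: mem_nth; rewrite size_tuple.
have LB y : y \in L -> exists u, y = B *m u.
  move=> /coord_vbasis yE; exists (\col_j coord (vbasis L) j y).
  by rewrite BE {1}yE; apply: eq_bigr => j _; rewrite mxE.
have Binj (u : 'cV[R]_(\dim L)) : B *m u = 0 -> u = 0.
  move=> Bu0; apply/matrixP => j k; rewrite (ord1 k) [RHS]mxE.
  have /freeP/(_ (fun j => u j 0)) := basis_free (vbasisP L).
  by apply; rewrite -BE.
have Ginj (u : 'cV[R]_(\dim L)) : B^T *m B *m u = 0 -> u = 0.
  move=> Gu0; apply/Binj/dotprod_eq0.
  by rewrite dotprodE trmx_mul -mulmxA (mulmxA B^T) Gu0 mulmx0 mxE.
have Gunit : B^T *m B \in unitmx.
  rewrite -unitmx_tr -row_free_unit -kermx_eq0; apply/eqP/row_matrixP => i.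
  rewrite row0; apply/trmx_inj; rewrite trmx0; apply: Ginj; apply: trmx_inj.
  by rewrite trmx_mul trmxK -row_mul mulmx_ker row0 trmx0.
exists (B *m invmx (B^T *m B) *m B^T) => x; split.
  by rewrite -!mulmxA; exact: BL.
move=> _ /LB[u ->]; rewrite dotprodE.
suff -> : (x - B *m invmx (B^T *m B) *m B^T *m x)^T *m (B *m u) = 0 by rewrite mxE.
apply: trmx_inj; rewrite trmx0 trmx_mul trmxK trmx_mul -mulmxA mulmxBr.
by rewrite !mulmxA mulmxV // mul1mx subrr mulmx0.
Qed.

Lemma orthogonal_projection_unique L (P Q : 'cV[R]_n -> 'cV[R]_n) :
  orthogonal_projection L P -> orthogonal_projection L Q -> P =1 Q.
Proof.
move=> PL QL x; have [Px Porth] := PL x; have [Qx Qorth] := QL x.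
apply/eqP; rewrite -subr_eq0; apply/eqP/dotprod_eq0.
have PQ : P x - Q x \in L by rewrite memvB.
have PQE : P x - Q x = (x - Q x) - (x - P x).
  by apply/matrixP => i j; rewrite !mxE; ring.
by rewrite {1}PQE dotprodBl Qorth // Porth // subrr.
Qed.

Lemma orthogonal_projection_fix L (P : 'cV[R]_n -> 'cV[R]_n) v :
  orthogonal_projection L P -> v \in L -> P v = v.
Proof.
move=> PL vL; have [PvL Porth] := PL v.
apply/esym/eqP; rewrite -subr_eq0; apply/eqP/dotprod_eq0/Porth.
by rewrite memvB.
Qed.

End EuclideanFacts.

(** * Topology of column vectors *)

Section Topology.
Context {R : realType}.

Lemma mulmx_continuous m n (A : 'M[R]_(m, n)) :
  continuous (mulmx A : 'cV[R]_n -> 'cV[R]_m).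
Proof.
have -> : mulmx A = fun x : 'cV[R]_n => \sum_j x j 0 *: col j A.
  apply/funext => x; apply/matrixP => i k; rewrite (ord1 k) mxE summxE.
  by apply: eq_bigr => j _; rewrite !mxE mulrC.
apply: (continuous_big add_continuous) => j _ x.
by apply: continuousZr_tmp; exact: coord_continuous.
Qed.

Lemma mulmx_subr_continuous m n (A : 'M[R]_(m, n)) (b : 'cV[R]_n) :
  continuous (fun x : 'cV[R]_n => A *m (x - b)).
Proof.
move=> x; apply: (@continuous_comp 'cV[R]_n 'cV[R]_n _ (fun x => x - b)).
  by apply: continuousB; [move=> ?; exact: cvg_id|exact: cst_continuous].
exact: mulmx_continuous.
Qed.

Lemma dotprod_continuous n : continuous (fun x : 'cV[R]_n => dotprod x x).
Proof.
apply: (continuous_big add_continuous) => i _ x.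
by apply: continuousM; exact: coord_continuous.
Qed.

Lemma enorm_continuous n : continuous (@enorm R n).
Proof.
move=> x; apply: (@continuous_comp _ _ _ (fun x => dotprod x x)).
  exact: dotprod_continuous.
exact: sqrt_continuous.
Qed.

Lemma enorm0 n : enorm (0 : 'cV[R]_n) = 0.
Proof.
by rewrite /enorm /dotprod big1 ?sqrtr0 // => i _; rewrite mxE mul0r.
Qed.

Lemma closed_zero m : closed [set (0 : 'cV[R]_m)].
Proof.
exact: (accessible_closed_set1 (hausdorff_accessible (@norm_hausdorff _ _))).
Qed.

Lemma closed_preimage (T U : topologicalType) (f : T -> U) (D : set U) :
  continuous f -> closed D -> closed (f @^-1` D).
Proof. by move=> fc; apply: preimage_closed => x _; exact: fc. Qed.

Lemma closed_vspace n (L : {vspace 'cV[R]_n}) : closed [set` L].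
Proof.
have [P PL] := orthogonal_projection_mx L.
suff -> : [set` L] = mulmx (1%:M - P) @^-1` [set 0].
  by apply: closed_preimage; [exact: mulmx_continuous|exact: closed_zero].
apply/seteqP; split=> x /=; rewrite mulmxBl mul1mx.
  by move=> xL; rewrite (orthogonal_projection_fix PL xL) subrr.
by move=> /eqP; rewrite subr_eq0 => /eqP ->; exact: (PL x).1.
Qed.

(** Heine-Borel for columns, by transposing the case of rows. *)
Lemma bounded_closed_compact_cV n (A : set 'cV[R]_n) :
  bounded_set A -> closed A -> compact A.
Proof.
have tr_cont p q : continuous (fun x : 'M[R]_(p, q) => x^T).
  have -> : (fun x : 'M[R]_(p, q) => x^T) = fun x : 'M[R]_(p, q) =>
     \sum_i \sum_j x i j *: delta_mx j i.
    apply/funext => x; rewrite {1}(matrix_sum_delta x) raddf_sum.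
    apply: eq_bigr => i _; rewrite raddf_sum; apply: eq_bigr => j _.
    by apply/matrixP => a b; rewrite !mxE andbC.
  apply: (continuous_big add_continuous) => i _.
  apply: (continuous_big add_continuous) => j _ x.
  by apply: continuousZr_tmp; exact: coord_continuous.
have tr_norm p q (x : 'M[R]_(p, q)) : `|x^T| <= `|x|.
  rewrite [leLHS]/Num.norm [leRHS]/Num.norm /= !mx_normrE.
  apply/bigmax_leP; split; first exact: bigmax_ge_id.
  move=> [i j] _ /=; rewrite mxE.
  exact: (le_bigmax _ (fun k => `|x k.1 k.2|) (j, i)).
move=> [M [Mreal MA]] Acl.
have -> : A = trmx @` (trmx @^-1` A : set 'rV[R]_n).
  apply/seteqP; split=> [x Ax|_ [y /= Ay <-]] //.
  by exists x^T => /=; rewrite trmxK.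
apply: continuous_compact; first by apply: continuous_subspaceT; exact: tr_cont.
apply: bounded_closed_compact; last by apply: closed_preimage => //; exact: tr_cont.
exists M; split=> // y /MA yM x /yM; apply: le_trans.
by have := tr_norm _ _ x^T; rewrite trmxK.
Qed.

End Topology.

(** * Polynomials restricted to lines *)

Section PolynomialsOnLines.
Context {R : realType}.

(** Write p = q X + c. Then q(t) = (p(t) - c) / t is bounded for t >= 1, hence
    constant by induction on the degree, and it tends to 0 at infinity. *)
Lemma bounded_poly_const (p : {poly R}) (M : R) :
  (forall t, 1 <= t -> `|p.[t]| <= M) -> exists c, p = c%:P.
Proof.
elim/poly_ind: p M => [|q c IHq] M pM; first by exists 0.
have p0 t : (q * 'X + c%:P).[t] = q.[t] * t + c by rewrite !hornerE.
have qM t : 1 <= t -> `|q.[t]| * t <= M + `|c|.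
  move=> t1; have t0 : 0 <= t by apply: le_trans t1.
  rewrite -{2}(ger0_norm t0) -normrM -lerBlDr.
  apply: le_trans (lerB_normD _ _) _.
  by rewrite -p0; exact: pM.
have [|k qk] := IHq (M + `|c|).
  move=> t t1; apply: le_trans (qM t t1).
  by rewrite ler_peMr.
suff k0 : k = 0 by exists c; rewrite qk k0 mul0r add0r.
apply/eqP; rewrite -normr_le0 leNgt; apply/negP => k_gt0.
have N0 : 0 <= M + `|c|.
  by apply: le_trans (qM 1 (lexx _)); rewrite mulr1.
(* At this t the bound on |k| t is violated. *)
have t1 : 1 <= (M + `|c|) / `|k| + 1 by rewrite lerDr divr_ge0.
have := qM _ t1; rewrite qk hornerC mulrDr mulr1 mulrC divfK ?gt_eqF //.
by rewrite gerDl leNgt k_gt0.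
Qed.

Lemma poly_eq_on_segment (p q : {poly R}) (e : R) : 0 < e ->
  (forall t, 0 <= t <= e -> p.[t] = q.[t]) -> p = q.
Proof.
move=> e0 pq; apply/eqP; rewrite -subr_eq0; apply: contrapT => /negP r0.
pose s := [seq e / k.+1%:R | k <- iota 0 (size (p - q))].
have : (size s < size (p - q)%R)%N.
  apply: max_poly_roots => //.
    apply/allP => _ /mapP[k _ ->]; rewrite rootE !hornerE pq ?subrr //.
    apply/andP; split; first by rewrite divr_ge0 // ltW.
    by rewrite ler_pdivrMr ?ltr0n // ler_peMr ?(ltW e0) // ler1n.
  rewrite map_inj_uniq ?iota_uniq // => i j /(mulfI (lt0r_neq0 e0)) /invr_inj.
  by move=> /eqP; rewrite eqr_nat eqSS => /eqP.
by rewrite size_map size_iota ltnn.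
Qed.

(** Together with continuity, the only property of polynomials on which
    attainment of the infimum depends. *)
Definition polynomial_on_lines n (f : 'cV[R]_n -> R) :=
  forall x d, exists p : {poly R}, forall t, f (x + t *: d) = p.[t].

Lemma polynomial_function_on_lines n (f : 'cV[R]_n -> R) :
  polynomial_function f -> polynomial_on_lines f.
Proof.
move=> [p fp] x d.
exists (\sum_(m <- mpoly.msupp p) (mpoly.mcoeff m p)%:P *
   \prod_i ((x i 0)%:P + (d i 0)%:P * 'X) ^+ (mpoly.fun_of_multinom m i)) => t.
rewrite fp mpoly.mevalE horner_sum; apply: eq_bigr => m _.
rewrite hornerM hornerC horner_prod; congr (_ * _).
by apply: eq_bigr => i _; rewrite !hornerE !mxE mulrC.
Qed.

Lemma polynomial_function_continuous n (f : 'cV[R]_n -> R) :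
  polynomial_function f -> continuous f.
Proof.
move=> [p fp].
have -> : f = fun x => \sum_(m <- mpoly.msupp p) mpoly.mcoeff m p *
   \prod_i (x i 0) ^+ (mpoly.fun_of_multinom m i).
  by apply/funext => x; rewrite fp mpoly.mevalE.
apply: (continuous_big add_continuous) => m _ x.
apply: continuousM; first exact: cst_continuous.
apply: (@continuous_big R^o _ *%R 1 xpredT (@mul_continuous R)) => i _ {}x.
apply: (@continuous_comp _ _ _ (fun x : 'cV[R]_n => x i 0) (fun y => y ^+ _)).
  exact: coord_continuous.
exact: exprn_continuous.
Qed.

Lemma quadratic_polynomial n (f : 'cV[R]_n -> R) :
  quadratic_function f -> polynomial_function f.
Proof.
move=> [A [b [c [_ fE]]]].
exists (mpoly.mpolyC n (2^-1 : R) * (\sum_i \sum_j mpoly.mpolyC n (A j i) *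
    (mpoly.mpolyX R (mpoly.mnm1 j) * mpoly.mpolyX R (mpoly.mnm1 i)))
  + \sum_i mpoly.mpolyC n (b i 0) * mpoly.mpolyX R (mpoly.mnm1 i)
  + mpoly.mpolyC n c) => x.
rewrite fE !mpoly.mevalD mpoly.mevalM !mpoly.mevalC; congr (_ * _ + _ + _).
  rewrite raddf_sum mxE; apply: eq_bigr => i _.
  rewrite mxE big_distrl raddf_sum; apply: eq_bigr => j _ /=.
  by rewrite !mpoly.mevalM mpoly.mevalC !mpoly.mevalXU !mxE; ring.
rewrite raddf_sum mxE; apply: eq_bigr => i _ /=.
by rewrite mpoly.mevalM mpoly.mevalC mpoly.mevalXU mxE.
Qed.

Lemma polynomial_on_lines_shift n (f : 'cV[R]_n -> R) v :
  polynomial_on_lines f -> polynomial_on_lines (fun x => f (x + v)).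
Proof.
move=> fl x d; have [p fp] := fl (x + v) d.
by exists p => t; rewrite -fp addrAC.
Qed.

End PolynomialsOnLines.

(** * Convex sets *)

Section Convexity.
Context {R : realType} {n : nat}.
Implicit Types (S C F : set 'cV[R]_n) (W V : {vspace 'cV[R]_n}).

Lemma convex_setP C : convex_set C <->
  forall x y t, C x -> C y -> 0 <= t <= 1 -> C (t *: x + (1 - t) *: y).
Proof.
split=> [Cc x y t Cx Cy /andP[t0 t1]|Cc x y l].
  have := Cc x y (Itv01 t0 t1) (mem_set Cx) (mem_set Cy).
  by rewrite inE.
rewrite !inE => Cx Cy; apply: (Cc) => //.
by apply/andP; split; [exact: ge0|exact: le1].
Qed.

Lemma convex_set3 C a b c (r s t : R) : convex_set C -> C a -> C b -> C c ->
  0 <= r -> 0 <= s -> 0 <= t -> r + s + t = 1 ->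
  C (r *: a + s *: b + t *: c).
Proof.
move=> /convex_setP Cc Ca Cb Cc' r0 s0 t0 rst.
have [rs0|rs0] := eqVneq (r + s) 0.
  move/eqP: rs0; rewrite paddr_eq0 // => /andP[/eqP r_0 /eqP s_0].
  by move: rst; rewrite r_0 s_0 !add0r !scale0r !add0r => ->; rewrite scale1r.
have rs_gt0 : 0 < r + s by rewrite lt_neqAle eq_sym rs0 addr_ge0.
have -> : r *: a + s *: b + t *: c =
    (r + s) *: (r / (r + s) *: a + (1 - r / (r + s)) *: b) + (1 - (r + s)) *: c.
  have -> : t = 1 - (r + s) by rewrite -rst addrAC subrr add0r.
  by apply/matrixP => i j; rewrite !mxE; field.
apply: (Cc) => //.
  apply: (Cc) => //; rewrite divr_ge0 ?(ltW rs_gt0) //=.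
  by rewrite ler_pdivrMr // mul1r lerDl.
by rewrite (ltW rs_gt0) -rst lerDl.
Qed.

(** The recession direction [d] is a cluster point of the unit vectors
    (y_k - x0) / |y_k - x0| for points y_k of [C] going to infinity: [x + t *: d]
    is then a cluster point of points of the segments from [x] to y_k. *)
Lemma unbounded_convex_recession C :
  C !=set0 -> closed C -> convex_set C -> ~ bounded_set C ->
  exists2 d, d != 0 & forall x t, C x -> 0 <= t -> C (x + t *: d).
Proof.
move=> [x0 Cx0] Ccl /convex_setP Cc unb.
have /choice[y yP] : forall k : nat, exists y, C y /\ k%:R < `|y - x0|.
  move=> k; apply: contrapT => nex; apply: unb.
  exists (k%:R + `|x0|); split; first by rewrite num_real.
  move=> M kM x Cx; apply: le_trans (ltW kM).
  rewrite -lerBlDr; apply: le_trans (lerB_dist _ _) _.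
  by rewrite leNgt; apply/negP => kx; apply: nex; exists x.
pose u k := `|y k - x0|^-1 *: (y k - x0).
have r_gt0 k : 0 < `|y k - x0| by apply: le_lt_trans (yP k).2.
have u1 k : `|u k| = 1.
  by rewrite normrZ normfV normr_id mulVf // gt_eqF.
have sphere_compact : compact [set v : 'cV[R]_n | `|v| = 1].
  apply: bounded_closed_compact_cV.
    exists 1; split; first exact: num_real.
    by move=> M M1 v /= ->; exact: ltW.
  apply: (@closed_preimage _ _ (fun v : 'cV[R]_n => `|v|) [set 1]).
    exact: norm_continuous.
  exact: closed_eq.
have [|d [/= d1 dcl]] := sphere_compact (u @ \oo) _.
  by exists 0%N => // k _ /=; exact: u1.
exists d; first by rewrite -normr_gt0 d1.
move=> x t Cx t0; apply: Ccl => B /nbhs_ballP[e /= e0 eB].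
(* K forces t <= |y_k - x0| and t |x0 - x| / |y_k - x0| <= e / 2 for k >= K. *)
have [K KP] : exists K : nat, Num.max t (2 * t * `|x0 - x| / e) <= K%:R.
  exists (Num.bound (Num.max t (2 * t * `|x0 - x| / e))).
  by apply/ltW/archi_boundP; rewrite le_max t0.
have dt : 0 < e / (2 * (t + 1)).
  by rewrite divr_gt0 // mulr_gt0 // ltr_wpDl.
have [_ [[k Kk <-] /= dk]] : [set u k | k in [set k | (K <= k)%N]] `&` ball d (e / (2 * (t + 1))) !=set0.
  apply: dcl; last exact: nbhsx_ballx.
  by exists K => // k Kk; exists k.
have [Cy ky] := yP k.
have r0 := r_gt0 k.
have Kr : K%:R < `|y k - x0| by apply: le_lt_trans ky; rewrite ler_nat.
move: KP; rewrite ge_max => /andP[tK xK].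
pose s := t / `|y k - x0|.
exists (s *: y k + (1 - s) *: x); split.
  apply: (Cc) => //; rewrite divr_ge0 //= ler_pdivrMr // mul1r.
  exact: le_trans (ltW Kr).
apply: eB; rewrite -ball_normE /=.
have -> : x + t *: d - (s *: y k + (1 - s) *: x) =
    t *: (d - u k) - s *: (x0 - x).
  by rewrite /u; apply/matrixP => i j; rewrite !mxE /s; ring.
apply: le_lt_trans (ler_normB _ _) _.
rewrite !normrZ (ger0_norm t0) ger0_norm ?divr_ge0 //.
have h1 : t * `|d - u k| < e / 2.
  move: dk; rewrite -ball_normE /= => dk.
  apply: (@le_lt_trans _ _ ((t + 1) * `|d - u k|)).
    by rewrite ler_wpM2r // lerDl.
  by rewrite mulrC -ltr_pdivlMr ?ltr_wpDl // -mulrA -invfM.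
have h2 : s * `|x0 - x| <= e / 2.
  have : 2 * t * `|x0 - x| / e <= `|y k - x0| by apply: le_trans (ltW Kr).
  rewrite ler_pdivrMr // => h.
  rewrite /s mulrAC ler_pdivrMr // mulrAC ler_pdivlMr //.
  by rewrite [leRHS]mulrC; apply: le_trans h; rewrite mulrC mulrA.
by rewrite [e]splitr ltr_leD.
Qed.

(** The direction space of the affine hull of a convex set. Convexity makes
    the multiples of differences closed under addition:
    l (a - b) + m (a' - b') = (l + m) (a'' - b'') with a'' and b'' the averages
    of a, a' and of b, b' with weights l and m, which exchanging a and b makes
    nonnegative. *)
Lemma convex_direction_vspace S : S !=set0 -> convex_set S ->
  exists W, forall w, w \in W <->
    exists l a b, [/\ S a, S b & w = l *: (a - b)].
Proof.
move=> [s0 Ss0] /convex_setP Sc.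
pose D w := exists l a b, [/\ S a, S b & w = l *: (a - b)].
have Dge0 w : D w -> exists l a b, [/\ 0 <= l, S a, S b & w = l *: (a - b)].
  move=> [l [a [b [Sa Sb ->]]]]; have [l0|l0] := leP 0 l; first by exists l, a, b.
  exists (- l), b, a; split=> //; first by rewrite oppr_ge0 ltW.
  by rewrite scaleNr -scalerN opprB.
have DZ c w : D w -> D (c *: w).
  by move=> [l [a [b [Sa Sb ->]]]]; exists (c * l), a, b; rewrite scalerA.
have [||W WE] := @linear_closed_vspace _ _ D.
- by exists 0, s0, s0; rewrite scale0r.
- move=> c u v /(DZ c) /Dge0[l [a [b [l0 Sa Sb ->]]]] Dv.
  have {Dv} /Dge0[m [a' [b' [m0 Sa' Sb' ->]]]] := Dv.
  have [lm|lm] := eqVneq (l + m) 0.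
    move/eqP: lm; rewrite paddr_eq0 // => /andP[/eqP -> /eqP ->].
    by exists 0, a, b; rewrite !scale0r addr0.
  have lm0 : 0 < l + m by rewrite lt_neqAle eq_sym lm addr_ge0.
  have t01 : 0 <= l / (l + m) <= 1.
    by rewrite divr_ge0 ?(ltW lm0) //= ler_pdivrMr // mul1r lerDl.
  exists (l + m), (l / (l + m) *: a + (1 - l / (l + m)) *: a'),
    (l / (l + m) *: b + (1 - l / (l + m)) *: b'); split; [exact: Sc..|].
  by apply/matrixP => i j; rewrite !mxE; field.
by exists W.
Qed.

(** A point [x] of the affine hull lies on a line through the barycentre [c]
    of the points of [S] that span it, and this line stays in [S] near [c];
    two polynomials in one variable that agree on a segment are equal. *)
Lemma eq_on_affine_hull S (f g : 'cV[R]_n -> R) : convex_set S ->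
  polynomial_on_lines f -> polynomial_on_lines g ->
  (forall x, S x -> f x = g x) ->
  forall s a b l, S s -> S a -> S b ->
    f (s + l *: (a - b)) = g (s + l *: (a - b)).
Proof.
move=> Sc fl gl fg s a b l Ss Sa Sb.
pose c := 3^-1 *: (s + a + b).
set x := s + _.
have [p fp] := fl c (x - c); have [q gq] := gl c (x - c).
suff pq : p = q.
  have -> : x = c + 1 *: (x - c) by rewrite scale1r addrC subrK.
  by rewrite fp gq pq.
have e0 : 0 < 1 + 3 * `|l| by rewrite ltr_wpDr // mulr_ge0.
(* For t up to this bound, the three weights below are nonnegative. *)
apply: (@poly_eq_on_segment _ _ _ ((1 + 3 * `|l|)^-1)); first by rewrite invr_gt0.
move=> t /andP[t0 te]; rewrite -fp -gq; apply: fg.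
have -> : c + t *: (x - c) = ((1 - t) / 3 + t) *: s +
    ((1 - t) / 3 + t * l) *: a + ((1 - t) / 3 - t * l) *: b.
  by rewrite /c /x; apply/matrixP => i j; rewrite !mxE; field.
have : t * (1 + 3 * `|l|) <= 1 by rewrite -ler_pdivlMr // div1r.
have := mulr_ge0 t0 (normr_ge0 l).
have : `|t * l| <= t * `|l| by rewrite normrM (ger0_norm t0).
rewrite ler_norml => /andP[h1 h2] h3 h4.
by apply: convex_set3 => //; lra.
Qed.

Definition minkowski_sum F V := [set y + v | y in F & v in [set` V]].

Lemma convex_minkowski_sum F V : convex_set F -> convex_set (minkowski_sum F V).
Proof.
move=> /convex_setP Fc; apply/convex_setP.
move=> _ _ t [x Fx [u /= uV <-]] [y Fy [v /= vV <-]] t01.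
exists (t *: x + (1 - t) *: y); first exact: Fc.
exists (t *: u + (1 - t) *: v); first by apply: memvD; apply: memvZ.
by rewrite !scalerDr addrACA.
Qed.

End Convexity.

(** * Asymptotes and closed images *)

Section Asymptotes.
Context {R : realType} {n : nat}.
Implicit Types (F M : set 'cV[R]_n) (L V : {vspace 'cV[R]_n}).

Lemma edistance0P F M : F !=set0 -> M !=set0 ->
  edistance F M = 0 <->
  forall e, 0 < e -> exists x y, [/\ F x, M y & enorm (x - y) < e].
Proof.
move=> [x0 Fx0] [y0 My0]; rewrite /edistance; set D := [set _ | _ in _ & _ in _].
have D0 : D !=set0 by exists (enorm (x0 - y0)); exists x0 => //; exists y0.
have Dlb : lbound D 0 by move=> _ [x _ [y _ <-]]; exact: sqrtr_ge0.
split=> [inf0 e e0|De].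
  have [|_ [x Fx [y My <-]]] := @inf_adherent _ D e e0.
    by split=> //; exists 0.
  by rewrite inf0 add0r => xye; exists x, y.
apply/le_anti/andP; split; last exact: lb_le_inf.
rewrite leNgt; apply/negP => /De[x [y [Fx My]]].
rewrite ltNge => /negP; apply; apply: ge_inf; first by exists 0.
by exists x => //; exists y.
Qed.

Lemma sqr_enorm_affine_quadratic (N : 'M[R]_n) x0 :
  quadratic_function (fun x : 'cV[R]_n => dotprod (N *m (x - x0)) (N *m (x - x0))).
Proof.
exists (2 *: (N^T *m N)), (- 2 *: (N^T *m N *m x0)), (dotprod (N *m x0) (N *m x0)).
split=> [|x]; first by rewrite linearZ /= trmx_mul trmxK.
rewrite mulmxBr dotprodB_sqr !(dotprodE _ (N *m x)).
rewrite -(dotprodE _ x) dotprodZl -mulmxA -scalemxAl -!dotprodE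
  (dotprodC x) dotprodZl.
rewrite mulKf // !dotprodE !trmx_mul trmxK !mulmxA; ring.
Qed.

Lemma sqr_enorm_affine_convex F (N : 'M[R]_n) x0 :
  convex_function F (fun x : 'cV[R]_n => dotprod (N *m (x - x0)) (N *m (x - x0))).
Proof.
move=> t x y _ _.
pose s : R := t%:inum; have s0 : 0 <= s by rewrite /s; exact: ge0.
have s1 : s <= 1 by rewrite /s; exact: le1.
change (dotprod (N *m (s *: x + (1 - s) *: y - x0))
  (N *m (s *: x + (1 - s) *: y - x0)) <=
  s * dotprod (N *m (x - x0)) (N *m (x - x0)) +
  (1 - s) * dotprod (N *m (y - x0)) (N *m (y - x0))).
have -> : N *m (s *: x + (1 - s) *: y - x0) =
    s *: (N *m (x - x0)) + (1 - s) *: (N *m (y - x0)).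
  rewrite !scalemxAr -mulmxDr; congr (_ *m _).
  by apply/matrixP => i j; rewrite !mxE; ring.
rewrite /dotprod !mulr_sumr -big_split; apply: ler_sum => i _ /=.
rewrite !mxE; set a := \sum_ _ _; set b := \sum_ _ _.
rewrite -subr_ge0.
suff -> : s * (a * a) + (1 - s) * (b * b)
    - (s * a + (1 - s) * b) * (s * a + (1 - s) * b) = s * (1 - s) * (a - b) ^+ 2.
  by apply: mulr_ge0; [apply: mulr_ge0; rewrite ?subr_ge0|exact: sqr_ge0].
ring.
Qed.

(** For an asymptote [x0 + L], the squared distance to it is a convex quadratic
    function whose infimum over [F] is 0; a point of [F] at which it is attained
    would lie on the asymptote. *)
Lemma no_asymptote_of_convex_quadratics F : F !=set0 ->
  (forall q : 'cV[R]_n -> R, quadratic_function q -> convex_function F q ->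
     bounded_below_on F q -> attains_infimum_on F q) ->
  ~ exists M, f_asymptote F M.
Proof.
move=> F0 Fq [M [[x0 [L ME]] FM0 dFM]].
have M0 : M !=set0.
  by exists x0; rewrite ME; exists 0; [exact: mem0v|rewrite addr0].
have [P PL] := orthogonal_projection_mx L.
pose N := 1%:M - P.
have NE (z : 'cV[R]_n) : N *m z = z - P *m z by rewrite mulmxBl mul1mx.
have NL (v : 'cV[R]_n) : v \in L -> N *m v = 0.
  by move=> vL; rewrite NE (orthogonal_projection_fix PL vL) subrr.
have N_contract (z : 'cV[R]_n) : dotprod (N *m z) (N *m z) <= dotprod z z.
  have [PzL Porth] := PL z; have := Porth _ PzL.
  rewrite NE dotprodBl => /subr0_eq zP.
  rewrite dotprodB_sqr (dotprodC (P *m z) z) zP.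
  have := dotprod_ge0 (P *m z); lra.
pose q (x : 'cV[R]_n) := dotprod (N *m (x - x0)) (N *m (x - x0)).
have [||| x Fx qx] := Fq q.
- exact: sqr_enorm_affine_quadratic.
- exact: sqr_enorm_affine_convex.
- by exists 0 => _ [x _ <-]; exact: dotprod_ge0.
have q0 : q x = 0.
  apply/le_anti; rewrite dotprod_ge0 andbT leNgt; apply/negP => qx0.
  have sq0 : 0 < Num.sqrt (q x) by rewrite sqrtr_gt0.
  have [x' [y [Fx' My xy]]] := (edistance0P F0 M0).1 dFM _ sq0.
  have : q x <= q x'.
    by rewrite qx; apply: ge_inf; [exists 0 => _ [z _ <-]; exact: dotprod_ge0|exists x'].
  apply/negP; rewrite -ltNge.
  have -> : q x' = dotprod (N *m (x' - y)) (N *m (x' - y)).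
    move: My; rewrite ME => -[v /= vL <-]; rewrite /q.
    by rewrite opprD addrA [in RHS]mulmxBr (NL v vL) subr0.
  apply: le_lt_trans (N_contract _) _.
  rewrite -enorm_sqr -[ltRHS](sqr_sqrtr (ltW qx0)).
  by rewrite ltr_pXn2r // nnegrE sqrtr_ge0.
have : (F `&` M) x.
  split=> //; rewrite ME; exists (x - x0); last by rewrite addrC subrK.
  move: q0 => /dotprod_eq0 /=; rewrite NE => /eqP; rewrite subr_eq0 => /eqP ->.
  exact: (PL _).1.
by rewrite FM0.
Qed.

(** If [z] is a limit of points of [T @` F] outside this image, the fibre of
    [T] over [z] is an asymptote: a linear right inverse of the linear part of
    [T] on its range moves a point [x] of [F] into the fibre by a displacement
    that vanishes as [T x] tends to [z]. *)
Lemma closed_image_of_no_asymptote F m (T : 'cV[R]_n -> 'cV[R]_m) :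
  F !=set0 -> ~ (exists M, f_asymptote F M) -> affine_mapping T ->
  closed (T @` F).
Proof.
move=> F0 noM [A [b TE]] z zcl; apply: contrapT => TFz; apply: noM.
pose B : 'M[R]_(n, m) := (pinvmx A^T)^T.
have ABA (x : 'cV[R]_n) : A *m (B *m (A *m x)) = A *m x.
  apply: trmx_inj; rewrite !trmx_mul !trmxK.
  by rewrite mulmxKpV // submxMl.
(* The fibre over z is nonempty because the range of T is closed. *)
have ABw : A *m (B *m (z - b)) = z - b.
  pose h (w : 'cV[R]_m) := (A *m B - 1%:M) *m (w - b).
  have h_closed : closed (h @^-1` [set 0]).
    apply: closed_preimage; first exact: mulmx_subr_continuous.
    exact: closed_zero.
  have : h z = 0.
    apply: h_closed; apply: closureS zcl => _ [x Fx <-] /=.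
    by rewrite /h TE addrK mulmxBl mul1mx -mulmxA ABA subrr.
  by rewrite /h mulmxBl mul1mx -mulmxA => /eqP; rewrite subr_eq0 => /eqP.
have [L LE] := mulmx_kernel_vspace A.
pose y0 := B *m (z - b).
pose M := [set y0 + v | v in [set` L]].
have MT y : M y <-> T y = z.
  rewrite TE /M; split=> [[v /= /LE Av <-]|Tz].
    by rewrite mulmxDr Av addr0 ABw subrK.
  exists (y - y0); last by rewrite addrC subrK.
  by apply/LE; rewrite mulmxBr ABw -Tz addrK subrr.
exists M; split; first by exists y0, L.
  apply/seteqP; split=> // x [Fx /MT Txz]; apply: TFz.
  by exists x.
apply/edistance0P => //; first by exists y0; exists 0; [exact: mem0v|rewrite addr0].
move=> e e0.
have [] := zcl [set u | enorm (B *m (u - z)) < e].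
  have hc : {for z, continuous (fun u : 'cV[R]_m => enorm (B *m (u - z)))}.
    apply: (@continuous_comp _ _ _ (fun u : 'cV[R]_m => B *m (u - z))).
      exact: mulmx_subr_continuous.
    exact: enorm_continuous.
  apply: (hc [set r | r < e]); rewrite subrr mulmx0 enorm0.
  by apply: open_nbhs_nbhs; split=> //; exact: open_lt.
move=> _ [[x Fx <-] /= Txe].
exists x, (x - B *m (T x - z)); split=> //; last by rewrite subKr.
apply/MT; rewrite !TE mulmxBr.
have -> : A *m x + b - z = A *m x - (z - b).
  by apply/matrixP => i j; rewrite !mxE; ring.
by rewrite (mulmxBr B) (mulmxBr A (B *m _)) ABA ABw subKr subrK.
Qed.

(** [F + V] is the preimage of the image of [F] under the projection onto the
    orthogonal complement of [V]. *)
Lemma closed_minkowski_sum_of_projections F V :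
  (forall L (P : 'cV[R]_n -> 'cV[R]_n),
     orthogonal_projection L P -> closed (P @` F)) ->
  closed (minkowski_sum F V).
Proof.
move=> Fcl; have [P PV] := orthogonal_projection_mx V.
pose Q (x : 'cV[R]_n) := (1%:M - P) *m x.
have QE x : Q x = x - P *m x by rewrite /Q mulmxBl mul1mx.
have [U UP] := mulmx_kernel_vspace P.
have QU : orthogonal_projection U Q.
  move=> x; have [PxV _] := PV x; split.
    by apply/UP; rewrite QE mulmxBr (orthogonal_projection_fix PV PxV) subrr.
  move=> y /UP Py; rewrite QE subKr dotprodC.
  by have [_ /(_ _ PxV)] := PV y; rewrite Py subr0.
have -> : minkowski_sum F V = Q @^-1` (Q @` F).
  apply/seteqP; split=> x.
    move=> [y Fy [v /= vV <-]]; exists y => //.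
    by rewrite !QE mulmxDr (orthogonal_projection_fix PV vV) opprD addrACA subrr addr0.
  move=> [y Fy]; rewrite !QE => Qyx; exists y => //.
  have [PxV _] := PV x; have [PyV _] := PV y.
  exists (P *m x - P *m y); first by rewrite /= memvB.
  by rewrite addrCA Qyx addrC subrK.
apply: closed_preimage; last exact: (Fcl U).
exact: mulmx_continuous.
Qed.

End Asymptotes.

(** * Attainment of the infimum *)

Section Attainment.
Context {R : realType} {n : nat}.
Implicit Types (S F : set 'cV[R]_n) (W V L : {vspace 'cV[R]_n}).

Lemma attains_infimumP F (f : 'cV[R]_n -> R) x :
  F x -> (forall y, F y -> f x <= f y) -> attains_infimum_on F f.
Proof.
move=> Fx xmin; exists x => //; apply/le_anti/andP; split.
  apply: lb_le_inf; first by exists (f x); exists x.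
  by move=> _ [y Fy <-]; exact: xmin.
apply: ge_inf; last by exists x.
by exists (f x) => _ [y Fy <-]; exact: xmin.
Qed.

(** Let [S] be the given convex sublevel set, [s0 + W] its affine hull and [V]
    the largest subspace of [W] along which [f] is constant on [s0 + W].
    Because [V] lies in [W] and [f] is invariant under it, [G = S + V] consists
    of the points of [F + V] that lie in [s0 + W] and satisfy [f x <= alpha], so
    it is closed. Let [G0] be the part of [G]
    orthogonal to [V], on which [f] takes the same values as on [S]. If [G0] is
    bounded, [f] attains its minimum there. Otherwise [G0] has a recession
    direction [d]; along [d], [f] is a bounded polynomial on half-lines, hence
    constant, first from the points of [S] and then on the affine hull. So [d]
    lies in [V] and is orthogonal to it, which is absurd. *)
Lemma attains_infimum_of_closed_sums F (f : 'cV[R]_n -> R) (alpha : R) :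
  (forall V, closed (minkowski_sum F V)) ->
  continuous f -> polynomial_on_lines f ->
  sublevel F f alpha !=set0 -> convex_set (sublevel F f alpha) ->
  bounded_below_on F f -> attains_infimum_on F f.
Proof.
move=> FVcl fcont fl; set S := sublevel F f alpha => S0 Sc [gamma fgamma].
have [s0 Ss0] := S0.
have [W WP] := convex_direction_vspace S0 Sc.
have SW x y : S x -> S y -> x - y \in W.
  by move=> Sx Sy; apply/WP; exists 1, x, y; rewrite scale1r.
have hull_eq (g h : 'cV[R]_n -> R) : polynomial_on_lines g -> polynomial_on_lines h ->
    (forall x, S x -> g x = h x) -> forall x, x - s0 \in W -> g x = h x.
  move=> gl hl gh x /WP[l [a [b [Sa Sb xE]]]].
  have -> : x = s0 + l *: (a - b) by rewrite -xE addrC subrK.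
  exact: (eq_on_affine_hull Sc).
have [||V VP] := @linear_closed_vspace _ _ (fun v => v \in W /\
    forall x t, x - s0 \in W -> f (x + t *: v) = f x).
- by split=> [|x t _]; [exact: mem0v|rewrite scaler0 addr0].
- move=> a u v [uW fu] [vW fv]; split; first by rewrite memvD // memvZ.
  move=> x t xW; rewrite scalerDr scalerA addrA fv ?fu //.
  by rewrite addrAC memvD // memvZ.
have fV x v : x - s0 \in W -> v \in V -> f (x + v) = f x.
  by move=> xW /VP[_ /(_ x 1 xW)]; rewrite scale1r.
pose G := minkowski_sum S V.
have GW x : G x -> x - s0 \in W.
  move=> [y Sy [v /= /VP[vW _] <-]].
  by rewrite addrAC memvD // SW.
have GE : G = minkowski_sum F V `&` ((fun x => x - s0) @^-1` [set` W]
    `&` f @^-1` [set a | a <= alpha]).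
  apply/seteqP; split=> x.
    move=> Gx; split; last split; last 1 first.
    - move: Gx => [y [Fy fy] [v /= vV <-]]; rewrite fV //.
      exact: SW.
    - by move: Gx => [y [Fy fy] [v /= vV <-]]; exists y => //; exists v.
    - exact: GW.
  move=> [[y Fy [v /= vV <-]] [/= xW fx]]; exists y; last by exists v.
  have yW : y - s0 \in W.
    have -> : y - s0 = y + v - s0 - v by rewrite (addrAC y) addrK.
    by rewrite memvB //; have [] := (VP v).1 vV.
  by split=> //; rewrite -(fV y v).
have Gcl : closed G.
  rewrite GE; apply: closedI; first exact: FVcl.
  apply: closedI.
    apply: closed_preimage; last exact: closed_vspace.
    by move=> x; apply: continuousB; [move=> ?; exact: cvg_id|exact: cst_continuous].
  by apply: closed_preimage => //; exact: closed_le.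
have [P PV] := orthogonal_projection_mx V.
pose G0 := G `&` mulmx P @^-1` [set 0].
have G0cl : closed G0.
  apply: closedI => //; apply: closed_preimage; first exact: mulmx_continuous.
  exact: closed_zero.
have G0c : convex_set G0.
  have /convex_setP Gc : convex_set G by exact: convex_minkowski_sum.
  apply/convex_setP => x y t [Gx /= Px] [Gy /= Py] t01; split; first exact: Gc.
  by rewrite /= mulmxDr -!scalemxAr Px Py !scaler0 addr0.
have SG0 x : S x -> G0 (x - P *m x).
  move=> Sx; have [PxV _] := PV x; split.
    by exists x => //; exists (- (P *m x)) => //=; rewrite memvN.
  by rewrite /= mulmxBr (orthogonal_projection_fix PV PxV) subrr.
have fSP x : S x -> f (x - P *m x) = f x.
  by move=> Sx; rewrite fV ?SW // memvN; exact: (PV x).1.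
have G0neq0 : G0 !=set0 by exists (s0 - P *m s0); exact: SG0.
have [G0b|G0unb] := pselect (bounded_set G0).
  have G0K := bounded_closed_compact_cV G0b G0cl.
  have [c] := compact_EVT_min G0neq0 G0K (continuous_subspaceT fcont).
  rewrite inE => -[[y Sy [v /= vV yvc]] _] cmin.
  apply: (@attains_infimumP _ _ y); first by case: Sy.
  move=> x Fx; have [fx|/ltW fx] := leP (f x) alpha; last first.
    by apply: le_trans fx; case: Sy.
  have Sx : S x by [].
  rewrite -(fSP x Sx) -(fV y v) ?SW // yvc.
  by apply: cmin; rewrite inE; exact: SG0.
exfalso.
have [d d0 drec] := unbounded_convex_recession G0neq0 G0cl G0c G0unb.
have [z [Gz Pz]] := G0neq0.
have [Gzd Pzd] := drec z 1 (conj Gz Pz) ler01.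
have Pd0 : P *m d = 0.
  by move: Pzd; rewrite /= scale1r mulmxDr Pz add0r.
have dW : d \in W.
  have -> : d = (z + 1 *: d - s0) - (z - s0).
    by rewrite scale1r; apply/matrixP => i j; rewrite !mxE; ring.
  by rewrite memvB // GW.
suff dV : d \in V by move/eqP: d0; apply; rewrite -(orthogonal_projection_fix PV dV).
apply/VP; split=> // x t; apply: (hull_eq (fun x => f (x + t *: d))) => //.
  exact: polynomial_on_lines_shift.
move=> {}x Sx; have [p fp] := fl x d.
have [|c pc] := @bounded_poly_const _ p (`|gamma| + `|alpha|).
  move=> {}t t1; have [[y Sy [v /= vV yvE]] _] : G0 (x - P *m x + t *: d).
    by apply: drec; [exact: SG0|apply: le_trans t1].
  (* The ray from x is the ray from its projection in G0, moved along V. *)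
  rewrite -fp -(fV _ (- (P *m x))) ?memvN; last 2 first.
  - by rewrite addrAC memvD ?SW // memvZ.
  - exact: (PV x).1.
  rewrite addrAC -yvE fV ?SW //.
  have [Fy fy] := Sy.
  have fy' : gamma <= f y by apply: fgamma; exists y.
  rewrite ler_norml; apply/andP; split.
    have := ler_norm (- gamma); rewrite normrN => ?; have := normr_ge0 alpha; lra.
  have := ler_norm alpha; have := normr_ge0 gamma; lra.
by rewrite -[in RHS](addr0 x) -(scale0r d) !fp pc !hornerC.
Qed.

End Attainment.

(** * The equivalence *)

Theorem theorem1 (R : realType) (n : nat) (F : set 'cV[R]_n)
    (F_neq0 : F !=set0) (F_convex : convex_set F) :
  [<-> (* 1 *)
       forall f : 'cV[R]_n -> R, polynomial_function f ->
         (exists a : R, sublevel F f a !=set0 /\ convex_set (sublevel F f a)) ->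
         bounded_below_on F f -> attains_infimum_on F f;
       (* 2 *)
       qFW_set F;
       (* 3 *)
       forall q : 'cV[R]_n -> R, quadratic_function q ->
         convex_function F q ->
         bounded_below_on F q -> attains_infimum_on F q;
       (* 4 *)
       ~ exists M : set 'cV[R]_n, f_asymptote F M;
       (* 5 *)
       forall (m : nat) (T : 'cV[R]_n -> 'cV[R]_m), affine_mapping T ->
         closed (T @` F);
       (* 6 *)
       forall (L : {vspace 'cV[R]_n}) (P : 'cV[R]_n -> 'cV[R]_n),
         orthogonal_projection L P -> closed (P @` F)].
Proof.
tfae.
- move=> Fpoly; split=> // f fquad fqc fbd.
  have [x Fx] := F_neq0.
  by apply: Fpoly => //; [exact: quadratic_polynomial|exists (f x); split=> //; exists x].
- move=> [_ FqFW] q qquad qconv qbd; apply: FqFW => // a.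
  apply/convex_setP => x y t [Fx qx] [Fy qy] t01.
  have /andP[t0 t1] := t01.
  split; first by move/convex_setP : F_convex; apply.
  apply: le_trans (qconv (Itv01 t0 t1) x y (mem_set Fx) (mem_set Fy)) _.
  have tx : t * q x <= t * a by rewrite ler_wpM2l.
  have ty : (1 - t) * q y <= (1 - t) * a by rewrite ler_wpM2l // subr_ge0.
  apply: le_trans (lerD tx ty) _.
  by rewrite -mulrDl addrC subrK mul1r.
- exact: no_asymptote_of_convex_quadratics.
- by move=> noM m T; exact: closed_image_of_no_asymptote.
- move=> Faff L P PL; have [A AL] := orthogonal_projection_mx L.
  apply: Faff; exists A, 0 => x.
  by rewrite addr0; exact: (orthogonal_projection_unique PL AL).
- move=> Fproj f fpoly [a [Sa0 Sac]] fbd.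
  apply: (@attains_infimum_of_closed_sums _ _ F f a) => //.
  + by move=> V; exact: closed_minkowski_sum_of_projections.
  + exact: polynomial_function_continuous.
  + exact: polynomial_function_on_lines.
Qed.
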